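(* Let $\vec v=(v_1,\dots,v_n)$ be a real vector with $n\ge 2$, let $a\ne0$ and $c$ be real numbers, and let $a\vec v+\vec c=(av_1+c,av_2+c,\dots,av_n+c)$. Then the rank of the loop cost $C_L(\vec v)$ among the loop costs of all permutations of $\vec v$ equals the rank of the loop cost $C_L(a\vec v+\vec c)$ among the loop costs of all permutations of $a\vec v+\vec c$.
   Context: For $\vec v=(v_1,\dots,v_n)$ with $n\ge2$, the loop cost is $C_L(\vec v)=v_1v_2+v_2v_3+\cdots+v_{n-1}v_n+v_nv_1$. If $A=\{a_1<a_2<\dots<a_k\}$ is the set of distinct values that the cost takes over all permutations of a given vector, listed in increasing order, then the rank of the cost $a_i$ is $i$ (so the minimum cost has rank $1$). *)

(* Defs.v *)
From HB Require Import structures.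
From mathcomp Require Import all_boot all_order all_algebra all_fingroup.
From mathcomp Require Import reals.

Set Implicit Arguments.
Unset Strict Implicit.
Unset Printing Implicit Defensive.

Import Order.TTheory GRing.Theory Num.Theory.

Local Open Scope ring_scope.

(* [ordS] is the cyclic successor on ['I_n], so the last summand is v_n v_1;
   for n = 2 the sum is v_1 v_2 + v_2 v_1. *)
Definition loop_cost (R : realType) (n : nat) (v : 'rV[R]_n) : R :=
  \sum_(i < n) v 0 i * v 0 (ordS i).

(* The distinct values a_1 < ... < a_k of the loop cost over all
   rearrangements of the entries of v, in increasing order. *)
Definition loop_cost_values (R : realType) (n : nat) (v : 'rV[R]_n) : seq R :=
  sort <=%R (undup [seq loop_cost (col_perm s v) | s : 'S_n]).

(* Ranks start at 1, whereas [index] counts from 0.  The value is meaningful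
   only when x is one of the values listed in [loop_cost_values v]. *)
Definition loop_cost_rank (R : realType) (n : nat) (v : 'rV[R]_n) (x : R)
    : nat :=
  (index x (loop_cost_values v)).+1.

(* Main.v *)
(** Replacing v by a v + c turns the loop cost x into
    a^2 x + 2 a c (v_1 + ... + v_n) + n c^2.  The sum of the entries does not
    depend on their order and a^2 > 0, so one and the same increasing affine
    map sends the list of costs of v to the list of costs of a v + c. *)
Require Import Defs.
From mathcomp Require Import all_boot all_order all_algebra all_fingroup.
From mathcomp Require Import reals ring.

Import Order.TTheory GRing.Theory Num.Theory.

Local Open Scope ring_scope.

(** Each entry lies in two of the cyclic products, once as left and once as right factor, so the
    cross terms add up to twice [a * c] times the sum of the entries. *)
Lemma loop_cost_affine (R : realType) (n : nat) (v : 'rV[R]_n) (a c : R) :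
  loop_cost (a *: v + const_mx c) =
  a ^+ 2 * loop_cost v + (a * c *+ 2 * (\sum_i v 0 i) + c ^+ 2 *+ n).
Proof.
have sumS : \sum_i v 0 (ordS i) = \sum_i v 0 i.
  by rewrite [RHS](reindex_inj (@ordS_inj n)).
(* One of the two copies of the sum is shifted by [ordS], and [c ^+ 2 *+ n] becomes a sum over
   ['I_n]; the identity then holds term by term. *)
rewrite /loop_cost mulr2n mulrDl -{1}sumS !mulr_sumr.
rewrite -[n in _ *+ n]card_ord -sumr_const -!big_split /=.
by apply: eq_bigr => i _; rewrite !mxE; ring.
Qed.

Lemma sum_col_perm (R : realType) (n : nat) (v : 'rV[R]_n) (s : 'S_n) :
  \sum_i col_perm s v 0 i = \sum_i v 0 i.
Proof.
rewrite [RHS](reindex_inj (@perm_inj _ s)).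
by apply: eq_bigr => i _; rewrite mxE.
Qed.

Lemma loop_cost_values_affine (R : realType) (n : nat) (v : 'rV[R]_n)
    (a c : R) : a != 0 ->
  loop_cost_values (a *: v + const_mx c) =
  [seq a ^+ 2 * x + (a * c *+ 2 * (\sum_i v 0 i) + c ^+ 2 *+ n)
     | x <- loop_cost_values v].
Proof.
move=> a0; set f := fun x : R => _.
have a2_gt0 : 0 < a ^+ 2 by rewrite exprn_even_gt0.
have f_mono : {mono f : x y / x <= y}.
  by move=> x y; rewrite /f lerD2r ler_pM2l.
have costs : [seq loop_cost (col_perm s (a *: v + const_mx c)) | s : 'S_n] =
    map f [seq loop_cost (col_perm s v) | s : 'S_n].
  rewrite -map_comp; apply: eq_map => s /=.
  have -> : col_perm s (a *: v + const_mx c) =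
      a *: col_perm s v + const_mx c by apply/matrixP => i j; rewrite !mxE.
  by rewrite loop_cost_affine sum_col_perm.
(* Injectivity of [f] lets it pass through [undup], monotonicity through [sort]. *)
rewrite /loop_cost_values costs undup_map_inj; last exact: inc_inj.
by rewrite -(map_sort (leT' := <=%R)) // => x y _ _; apply: f_mono.
Qed.

Theorem lemma5 (R : realType) (n : nat) (hn : (2 <= n)%N) (v : 'rV[R]_n)
    (a c : R) (ha : a != 0) :
  loop_cost_rank v (loop_cost v) =
  loop_cost_rank (a *: v + const_mx c) (loop_cost (a *: v + const_mx c)).
Proof.
rewrite /loop_cost_rank loop_cost_values_affine // loop_cost_affine.
(* An injective map keeps the position of an element in a list. *)
rewrite (index_map (f := fun x => a ^+ 2 * x + _)) // => x y /addIr.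
by apply: mulfI; rewrite expf_neq0.
Qed.
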